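(* Let $\alpha\in(0,1)$, $T>0$, $r>0$ and $\phi\in C([-r,0],\mathbb{R})$. Let $f:[0,T]\times\mathbb{R}^2\to\mathbb{R}$ be a continuous function, and assume that there exists a constant $L>0$ such that $$|f(t,u_1,w)-f(t,u_2,w)|\le L|u_1-u_2|$$ for all $u_1,u_2,w\in\mathbb{R}$ and all $t\in[0,T]$. Then the constant-delay problem $$\begin{cases}{}^{c}D^{\alpha}\upsilon(t)=f(t,\upsilon(t),\upsilon(t-r)), & t\in[0,T],\\ \upsilon(t)=\phi(t), & t\in[-r,0],\end{cases}$$ has a unique solution $\upsilon\in C([-r,T],\mathbb{R})$.
   Context: ${}^{c}D^{\alpha}$ denotes the Caputo fractional derivative of order $\alpha\in(0,1)$ with base point $0$, which for sufficiently regular $\upsilon$ is ${}^{c}D^{\alpha}\upsilon(t)=\frac{1}{\Gamma(1-\alpha)}\int_0^t(t-s)^{-\alpha}\upsilon'(s)\,ds$. The Riemann–Liouville integral is $I^{\alpha}q(t)=\frac{1}{\Gamma(\alpha)}\int_0^t(t-s)^{\alpha-1}q(s)\,ds$. Convention: for continuous $\upsilon$ and continuous $q:[0,T]\to\mathbb{R}$, the equation ${}^{c}D^{\alpha}\upsilon(t)=q(t)$ on $[0,T]$ is understood in its equivalent integral form $\upsilon(t)=\upsilon(0)+I^{\alpha}q(t)$ for all $t\in[0,T]$. Thus a solution of the problem is a function $\upsilon\in C([-r,T],\mathbb{R})$ with $\upsilon(t)=\phi(t)$ for $t\in[-r,0]$ and $$\upsilon(t)=\phi(0)+\frac{1}{\Gamma(\alpha)}\int_0^t(t-s)^{\alpha-1}f(s,\upsilon(s),\upsilon(s-r))\,ds,\qquad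 t\in[0,T].$$ *)

(* Defs.v *)
From mathcomp Require Import all_boot all_order all_algebra.
From mathcomp Require Import all_classical all_reals all_analysis.

Set Implicit Arguments.
Unset Strict Implicit.
Unset Printing Implicit Defensive.

Import Order.TTheory GRing.Theory Num.Theory.
Import numFieldNormedType.Exports.

Local Open Scope classical_set_scope.
Local Open Scope ring_scope.

Definition Gamma (R : realType) (a : R) : R :=
  \int[lebesgue_measure]_(s in `]0, +oo[) (s `^ (a - 1) * expR (- s)).

(* Riemann-Liouville integral with base point 0, as a Lebesgue integral.  At
   the singular endpoint s = t the integrand takes the value 0 when a != 1
   (convention of [powR]); this is a null set. *)
Definition RL_integral (R : realType) (a : R) (q : R -> R) (t : R) : R :=
  (Gamma a)^-1 *
    \int[lebesgue_measure]_(s in `[0, t]) ((t - s) `^ (a - 1) * q s).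

(* The equation cD^a v = q on [0, T], for v and q continuous there, understood
   in its integral form v = v(0) + I^a q; no differentiability of v is asked. *)
Definition caputo_eq (R : realType) (a T : R) (v q : R -> R) : Prop :=
  forall t, 0 <= t <= T -> v t = v 0 + RL_integral a q t.

(* Elements of C([-r, T], R) are represented by total functions, of which only
   the values on [-r, T] matter.  The right-hand side of the equation is
   continuous on [0, T] whenever v is continuous on [-r, T] and f is continuous
   on [0, T] x R^2. *)
Definition delay_solution (R : realType) (a T r : R) (phi : R -> R)
    (f : R -> R -> R -> R) (v : R -> R) : Prop :=
  [/\ {within `[- r, T], continuous v},
      caputo_eq a T v (fun t => f t (v t) (v (t - r)))
    & forall t, - r <= t <= 0 -> v t = phi t].

(* Main.v *)
Require Import Defs.
From mathcomp Require Import all_boot all_order all_algebra.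
From mathcomp Require Import all_classical all_reals all_analysis.
From mathcomp Require Import measurable_realfun ring lra.

Set Implicit Arguments.
Unset Strict Implicit.
Unset Printing Implicit Defensive.

Import Order.TTheory GRing.Theory Num.Theory.
Import numFieldNormedType.Exports.

Local Open Scope classical_set_scope.
Local Open Scope ring_scope.

(** Extend [f] and [phi] to everywhere continuous data by clamping their real
    arguments.  For a frozen delayed term the equation is a Volterra equation with
    weakly singular kernel and a right-hand side that is Lipschitz in the unknown.
    The Riemann-Liouville integral operator maps continuous functions to continuous
    (Hölder) ones, and it is a contraction for the weighted sup norm
    [sup |u t| exp (- l t)] once [l] is large, so Picard iteration converges and
    the solution is unique.  In the method of steps, the solution up to time
    [k r] is frozen in the delayed term and the equation is solved again from the
    base point 0 on all of [[0, T]]; by uniqueness the new solution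
    agrees with the old one up to [k r], hence solves the delay equation up to
    [(k + 1) r].  The value of the constant [(Gamma a)^-1] plays no
    role. *)

(** * The weakly singular Abel kernel: its integral and integrability *)

Section abel_kernel.
Context {R : realType}.
Variable a : R.
Hypothesis a_gt0 : 0 < a.
Notation mu := (@lebesgue_measure R).
Implicit Types (q : R -> R) (x y t : R).

Lemma measurable_abel_kernel t (D : set R) : measurable D ->
  measurable_fun D (fun s => (t - s) `^ (a - 1)).
Proof.
move=> mD; apply: (measurable_funS measurableT) => //.
apply: (measurableT_comp (measurable_powR (a - 1))).
by apply: measurable_funB.
Qed.

Lemma is_derive_abel_primitive t x : x < t ->
  is_derive x 1 (fun s => - a^-1 * (t - s) `^ a) ((t - x) `^ (a - 1)).
Proof.
move=> xt.
have dB : is_derive x 1 (fun s : R => t - s) (- 1).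
  by have := is_deriveB (is_derive_cst t x 1) (is_derive_id x 1); rewrite sub0r.
have dP : is_derive (t - x) 1 (fun s : R => s `^ a) (a * (t - x) `^ (a - 1)).
  by apply: is_derive1_powR; rewrite subr_gt0.
have dC := @is_derive1_comp R _ _ x _ _ dP dB.
have := @is_deriveZ _ _ _ _ (- a^-1) x 1 _ dC.
rewrite /= => dZ; apply: is_derive_eq dZ _.
rewrite /GRing.scale /= mulrN1 mulrNN mulrA mulVf ?mul1r//.
by rewrite gt_eqF.
Qed.

Lemma continuous_abel_kernel t x : x < t ->
  {for x, continuous (fun s => (t - s) `^ (a - 1))}.
Proof.
move=> xt.
have dB : is_derive x 1 (fun s : R => t - s) (- 1).
  by have := is_deriveB (is_derive_cst t x 1) (is_derive_id x 1); rewrite sub0r.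
have dP : is_derive (t - x) 1 (fun s : R => s `^ (a - 1))
    ((a - 1) * (t - x) `^ (a - 1 - 1)).
  by apply: is_derive1_powR; rewrite subr_gt0.
have dC := @is_derive1_comp R _ _ x _ _ dP dB.
by apply: differentiable_continuous; apply/derivable1_diffP; apply: ex_derive.
Qed.

(** The upper limit [y] stays strictly below the singularity [t], so the primitive is differentiable
    on the whole closed interval and the fundamental theorem of calculus applies. *)
Lemma integral_abel_kernel x y t : x < y -> y < t ->
  (\int[mu]_(s in `[x, y]) ((t - s) `^ (a - 1))%:E =
   (a^-1 * ((t - x) `^ a - (t - y) `^ a))%:E)%E.
Proof.
move=> xy yt.
pose F (s : R) := - a^-1 * (t - s) `^ a.
have dF s : s <= y -> is_derive s 1 F ((t - s) `^ (a - 1)).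
  by move=> sy; apply: is_derive_abel_primitive; exact: le_lt_trans yt.
have cF s : s <= y -> {for s, continuous F}.
  move=> /dF sy; apply: differentiable_continuous; apply/derivable1_diffP.
  exact: ex_derive.
rewrite (@continuous_FTC2 _ _ F) //.
- by rewrite -EFinB; congr EFin; rewrite /F; ring.
- apply: continuous_in_subspaceT => s; rewrite inE/= in_itv/= => /andP[_ sy].
  exact: continuous_abel_kernel (le_lt_trans sy yt).
- split.
  + move=> s; rewrite in_itv/= => /andP[_ sy].
    by have := dF _ (ltW sy) => ?; apply: ex_derive.
  + by apply: cvg_at_right_filter; apply: cF; exact: ltW.
  + by apply: cvg_at_left_filter; apply: cF.
- move=> s; rewrite in_itv/= => /andP[_ sy].
  by have := dF _ (ltW sy) => ?; rewrite derive1E; apply: derive_val.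
Qed.

(** By monotone convergence over intervals that exhaust [[x, t[], the integral is a limit of
    explicit values; dropping a nonnegative term from each leaves the bound. This gives
    integrability up to the singularity. *)
Lemma integral_abel_kernel_le x t : x <= t ->
  (\int[mu]_(s in `[x, t]) ((t - s) `^ (a - 1))%:E <=
   (a^-1 * (t - x) `^ a)%:E)%E.
Proof.
rewrite le_eqVlt => /predU1P[->|xt].
  rewrite set_itv1 integral_set1 lee_fin mulr_ge0 ?powR_ge0//.
  by rewrite invr_ge0 ltW.
rewrite -integral_itv_bndo_bndc; last first.
  by apply/measurable_EFinP; apply: measurable_abel_kernel.
(* With [n.+2] these points lie strictly between [x] and [t] already for [n = 0]; they increase to
   [t]. *)
pose y_ n : R := t - (t - x) / n.+2%:R.
have tx0 : 0 < t - x by rewrite subr_gt0.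
have xy n : x < y_ n.
  rewrite /y_ ltrBrDr -ltrBrDl ltr_pdivrMr// ltr_pMr// ltr1n//.
have yt n : y_ n < t by rewrite /y_ ltrBlDr ltrDl divr_gt0.
pose F n : set R := `[x, y_ n]%classic.
have -> : `[x, t[%classic = \bigcup_n F n.
  apply/seteqP; split => s /=; rewrite in_itv/=.
    move=> /andP[xs st].
    have ts0 : 0 < t - s by rewrite subr_gt0.
    exists (Num.truncn ((t - x) / (t - s))) => //.
    rewrite /F/= in_itv/= xs/= /y_ lerBrDr -lerBrDl.
    rewrite ler_pdivrMr// mulrC -ler_pdivrMr//.
    apply/ltW; apply: lt_trans (Num.Theory.truncnS_gt _) _.
    by rewrite ltr_nat.
  move=> [n _]; rewrite /F/= in_itv/= => /andP[-> /=] /le_lt_trans; exact.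
have cF : (\int[mu]_(s in F i) ((t - s) `^ (a - 1))%:E @[i --> \oo] -->
    \int[mu]_(s in \bigcup_i F i) ((t - s) `^ (a - 1))%:E)%E.
  apply: ge0_nondecreasing_set_cvg_integral => //.
  - apply/nondecreasing_seqP => n; rewrite subsetEset => s.
    rewrite /F/= !in_itv/= => /andP[-> /=] /le_trans; apply.
    rewrite /y_ lerD2l lerN2 ler_pM2l// lef_pV2 ?posrE ?ltr0n//.
    by rewrite ler_nat.
  - by move=> i; exact: measurable_itv.
  - move=> i; apply/measurable_EFinP; apply: measurable_abel_kernel; exact: measurable_itv.
  - by move=> i s _; rewrite lee_fin powR_ge0.
rewrite -(cvg_lim _ cF)//; apply: lime_le; first by apply: cvgP cF.
apply: nearW => n; rewrite integral_abel_kernel// lee_fin.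
rewrite ler_pM2l ?invr_gt0// gerBl; exact: powR_ge0.
Qed.

Lemma integrable_abel_kernel x y t : y <= t ->
  mu.-integrable `[x, y] (EFin \o (fun s => (t - s) `^ (a - 1))).
Proof.
move=> yt; have [yx|xy] := ltP y x.
  by rewrite set_itv_ge ?bnd_simp -?ltNge//; exact: integrable_set0.
apply: (@integrableS _ _ _ mu `[x, t]%classic) => //.
  by apply: subset_itvl; rewrite bnd_simp.
apply/integrableP; split.
  by apply/measurable_EFinP; apply: measurable_abel_kernel.
under eq_integral do rewrite /= ger0_norm ?powR_ge0//.
apply: le_lt_trans (integral_abel_kernel_le (le_trans xy yt)) _.
exact: ltry.
Qed.

(** A continuous [q] is bounded on the compact interval, and a bounded measurable factor preserves
    integrability. *)
Lemma integrable_abel_kernelM q x y t : continuous q -> y <= t ->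
  mu.-integrable `[x, y] (EFin \o (fun s => (t - s) `^ (a - 1) * q s)).
Proof.
move=> cq yt.
have := @integrableMl _ _ R mu `[x, y] _ _ q (@integrable_abel_kernel x y t yt).
apply => //.
  by apply: (measurable_funS measurableT) => //; apply: continuous_measurable_fun.
have /compact_bounded [M [_ hM]] : compact (q @` `[x, y]).
  by apply: continuous_compact; [exact: continuous_subspaceT | exact: segment_compact].
by exists M; split; rewrite ?num_real// => ? ? ? ?; exact: hM.
Qed.

Lemma Rintegral_abel_kernel_le x t : x <= t ->
  \int[mu]_(s in `[x, t]) ((t - s) `^ (a - 1)) <= a^-1 * (t - x) `^ a.
Proof.
move=> xt; rewrite -lee_fin fineK; first exact: integral_abel_kernel_le.
exact: integrable_fin_num (integrable_abel_kernel _ (lexx t)).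
Qed.
End abel_kernel.

(** * Exponentially weighted bounds for the Riemann-Liouville operator *)

Lemma Rintegral_expR {R : realType} (l x y : R) : 0 < l -> x < y ->
  \int[lebesgue_measure]_(s in `[x, y]) expR (l * s) =
  l^-1 * (expR (l * y) - expR (l * x)).
Proof.
move=> l0 xy.
pose F (s : R) := l^-1 * expR (l * s).
have dF (s : R) : is_derive s 1 F (expR (l * s)).
  have dM : is_derive s 1 (fun u : R => l * u) l.
    have := is_deriveZ l (is_derive_id s 1).
    by rewrite /GRing.scale/= mulr1.
  have dC := @is_derive1_comp R _ _ s _ _ (is_derive_expR (l * s)) dM.
  have := is_deriveZ l^-1 dC.
  by rewrite /GRing.scale/= mulrCA mulVf ?gt_eqF// mulr1.
have cF : continuous F.
  move=> s; apply: differentiable_continuous; apply/derivable1_diffP.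
  by have := dF s => ?; apply: ex_derive.
rewrite /Rintegral (@continuous_FTC2 _ _ F)//.
- by rewrite -EFinB/= /F mulrBr.
- apply: continuous_subspaceT => s.
  have -> : (fun s => expR (l * s)) = (fun s => l * F s).
    by apply/funext => u; rewrite /F mulrA mulfV ?gt_eqF// mul1r.
  by apply: cvgM; [exact: cvg_cst | exact: cF].
- split.
  + by move=> s _; have := dF s => ?; apply: ex_derive.
  + by apply: cvg_at_right_filter; apply: cF.
  + by apply: cvg_at_left_filter; apply: cF.
- by move=> s _; have := dF s => ?; rewrite derive1E; apply: derive_val.
Qed.

Lemma continuous_expRM {R : realType} (l : R) : continuous (fun s => expR (l * s)).
Proof.
move=> s; apply: (@continuous_comp _ _ _ (fun s => l * s) expR).
  by apply: cvgM; [exact: cvg_cst | exact: cvg_id].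
exact: continuous_expR.
Qed.

Section riemann_liouville.
Context {R : realType}.
Variable a : R.
Hypothesis ha : 0 < a < 1.
Notation mu := (@lebesgue_measure R).
Notation J := (RL_integral a).
Implicit Types (q : R -> R) (x y t : R).

Let a_gt0 : 0 < a. Proof. by case/andP: ha. Qed.

Lemma abel_kernel_anti x y : 0 < x -> x <= y -> y `^ (a - 1) <= x `^ (a - 1).
Proof.
move=> x0 xy; have y0 := lt_le_trans x0 xy.
have -> : a - 1 = - (1 - a) by ring.
rewrite !powRN lef_pV2 ?posrE ?powR_gt0//.
apply: ge0_ler_powR => //; rewrite ?nnegrE; [|exact: ltW..].
by rewrite subr_ge0; case/andP: ha => _ /ltW.
Qed.

(* Split the integral at distance [d] from the singularity: the singular part is
   at most [d `^ a / a * expR (l * t)], the other one at most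
   [d `^ (a - 1) / l * expR (l * t)]. *)
Lemma Rintegral_abel_kernel_expR_le (e : R) : 0 < e ->
  exists2 l : R, 0 < l & forall t, 0 <= t ->
    \int[mu]_(s in `[0, t]) ((t - s) `^ (a - 1) * expR (l * s)) <=
    e * expR (l * t).
Proof.
move=> e0.
(* [d] solves [d^a / a = e / 2], and [l] below solves [d^(a - 1) / l = e / 2]: each part of the
   split costs half of [e]. *)
pose d := (a * (e / 2)) `^ a^-1.
have d0 : 0 < d by rewrite powR_gt0// mulr_gt0// divr_gt0.
have dE : a^-1 * d `^ a = e / 2.
  rewrite /d -powRrM mulVf ?gt_eqF// powRr1; last first.
    by rewrite ltW// mulr_gt0// divr_gt0.
  by field; rewrite gt_eqF.
pose l := 2 * d `^ (a - 1) / e.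
have l0 : 0 < l by rewrite divr_gt0// mulr_gt0// powR_gt0.
have lE : d `^ (a - 1) * l^-1 = e / 2.
  have h : d `^ (a - 1) != 0 by rewrite gt_eqF// powR_gt0.
  by rewrite /l; field; rewrite h gt_eqF.
have ce := @continuous_expRM _ l.
exists l => // t t0.
have ik x y : y <= t -> mu.-integrable `[x, y]
    (EFin \o (fun s => (t - s) `^ (a - 1) * expR (l * s))).
  by apply: integrable_abel_kernelM.
have sing x : 0 <= x <= t -> t - x <= d ->
    \int[mu]_(s in `[x, t]) ((t - s) `^ (a - 1) * expR (l * s)) <=
    e / 2 * expR (l * t).
  move=> /andP[x0 xt] txd.
  apply: (@le_trans _ _ (\int[mu]_(s in `[x, t]) ((t - s) `^ (a - 1) * expR (l * t)))).
    apply: le_Rintegral => //.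
    - exact: ik.
    - by apply: (integrable_abel_kernelM a_gt0) => //; exact: cst_continuous.
    - move=> s /=; rewrite in_itv/= => /andP[_ st].
      by rewrite ler_wpM2l ?powR_ge0// ler_expR ler_pM2l.
  rewrite RintegralZr//; last exact: integrable_abel_kernel.
  rewrite ler_pM2r ?expR_gt0//.
  apply: le_trans (Rintegral_abel_kernel_le a_gt0 xt) _.
  rewrite -dE ler_pM2l ?invr_gt0//.
  by apply: ge0_ler_powR; rewrite ?nnegrE ?subr_ge0// ltW.
(* When [t <= d] the whole interval counts as the singular part. *)
have [td|dt] := leP t d.
  apply: le_trans (sing 0 _ _) _; rewrite ?subr0 ?lexx ?t0//.
  by rewrite ler_pM2r ?expR_gt0// ler_pdivrMr// ler_peMr// ?ltW// ltr1n.
have c0 : 0 < t - d by rewrite subr_gt0.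
have ct : t - d <= t by rewrite gerBl ltW.
rewrite -(subrK (\int[mu]_(s in `[0, (t - d)]) ((t - s) `^ (a - 1) * expR (l * s)))
  (\int[mu]_(s in `[0, t]) _)).
rewrite Rintegral_itvB//; last 2 first.
- exact: ik.
- by rewrite bnd_simp ltW.
rewrite Rintegral_itv_obnd_cbnd; last first.
  apply: integrableS (ik (t - d) t (lexx t)) => //.
  by apply: subset_itvr; rewrite bnd_simp.
have -> : e * expR (l * t) = e / 2 * expR (l * t) + e / 2 * expR (l * t) by field.
apply: lerD.
  apply: sing; first by rewrite (ltW c0).
  by rewrite opprB addrC subrK.
apply: (@le_trans _ _ (\int[mu]_(s in `[0, (t - d)]) (d `^ (a - 1) * expR (l * s)))).
  apply: le_Rintegral => //.
  - exact: ik.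
  - apply: continuous_compact_integrable; first exact: segment_compact.
    apply: continuous_subspaceT => s.
    by apply: cvgM; [exact: cvg_cst | exact: ce].
  - move=> s /=; rewrite in_itv/= => /andP[_ sd].
    rewrite ler_pM2r ?expR_gt0//; apply: abel_kernel_anti => //.
    by rewrite lerBrDr addrC -lerBrDr.
rewrite RintegralZl//; last first.
  apply: continuous_compact_integrable; first exact: segment_compact.
  exact: continuous_subspaceT.
rewrite Rintegral_expR// mulrA lE ler_pM2l ?divr_gt0//.
rewrite mulr0 expR0; apply: (@le_trans _ _ (expR (l * (t - d)))).
  by rewrite gerBl.
by rewrite ler_expR ler_pM2l.
Qed.

Lemma eq_RL_integral q1 q2 t : (forall s, 0 <= s <= t -> q1 s = q2 s) ->
  J q1 t = J q2 t.
Proof.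
move=> q12; congr (_ * _); apply: eq_Rintegral => s.
by rewrite inE/= in_itv/= => /q12 ->.
Qed.

(** The domain of integration is empty or a single point. Hence an equation [V t = h t + J q t]
    posed for all [t <= T] also encodes the history [V = h] at times [t <= 0]. *)
Lemma RL_integral_le0 q t : t <= 0 -> J q t = 0.
Proof.
rewrite /RL_integral le_eqVlt => /predU1P[->|t0].
  by rewrite set_itv1 Rintegral_set1 mulr0.
by rewrite set_itv_ge ?bnd_simp -?ltNge// Rintegral_set0 mulr0.
Qed.

Lemma RL_integralB_le q1 q2 g t : continuous q1 -> continuous q2 ->
  continuous g -> (forall s, 0 <= s <= t -> `|q1 s - q2 s| <= g s) ->
  `|J q1 t - J q2 t| <= `|(Gamma a)^-1| *
    \int[mu]_(s in `[0, t]) ((t - s) `^ (a - 1) * g s).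
Proof.
move=> c1 c2 cg hg.
rewrite /RL_integral -mulrBr normrM ler_wpM2l//.
have i1 := integrable_abel_kernelM a_gt0 0 c1 (lexx t).
have i2 := integrable_abel_kernelM a_gt0 0 c2 (lexx t).
have ig := integrable_abel_kernelM a_gt0 0 cg (lexx t).
have cB : continuous (fun s => q1 s - q2 s).
  by move=> s; apply: cvgB; [exact: c1 | exact: c2].
have iB := integrable_abel_kernelM a_gt0 0 cB (lexx t).
rewrite -RintegralB//.
under eq_Rintegral do rewrite -mulrBr.
apply: le_trans (le_normr_Rintegral _ iB) _ => //.
apply: le_Rintegral => //.
  exact: integrable_norm iB.
move=> s /=; rewrite in_itv/= => hs.
by rewrite normrM ger0_norm ?powR_ge0// ler_wpM2l ?powR_ge0// hg.
Qed.

(** The kernel estimate returns the weight [expR (l * t)] with an arbitrarily small factor. One [l]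
    serves all [q1], [q2], [B] and [t], which makes the bound usable in an iteration. *)
Lemma RL_integral_weighted (e : R) : 0 < e ->
  exists2 l : R, 0 < l & forall q1 q2 (B t : R), continuous q1 -> continuous q2 ->
    0 <= t -> 0 <= B ->
    (forall s, 0 <= s <= t -> `|q1 s - q2 s| <= B * expR (l * s)) ->
    `|J q1 t - J q2 t| <= e * B * expR (l * t).
Proof.
(* Adding 1 makes [K] positive whatever the value of [Gamma a], so the kernel bound can be taken
   with [e / K]. *)
move=> e0; pose K := `|(Gamma a)^-1| + 1.
have K0 : 0 < K by rewrite ltr_wpDl.
have [l l0 hl] := Rintegral_abel_kernel_expR_le (divr_gt0 e0 K0).
exists l => // q1 q2 B t c1 c2 t0 B0 h.
have cBe : continuous (fun s => B * expR (l * s)).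
  by move=> s; apply: cvgM; [exact: cvg_cst | exact: continuous_expRM].
apply: le_trans (RL_integralB_le c1 c2 cBe h) _.
have -> : \int[mu]_(s in `[0, t]) ((t - s) `^ (a - 1) * (B * expR (l * s))) =
    B * \int[mu]_(s in `[0, t]) ((t - s) `^ (a - 1) * expR (l * s)).
  rewrite -RintegralZl//; first by apply: eq_Rintegral => s _; rewrite mulrCA.
  by apply: (integrable_abel_kernelM a_gt0) => //; exact: continuous_expRM.
apply: (@le_trans _ _ (K * (B * (e / K * expR (l * t))))).
  apply: ler_pM => //.
  - by rewrite mulr_ge0// Rintegral_ge0// => s _; rewrite mulr_ge0 ?powR_ge0 ?expR_ge0.
  - by rewrite lerDl.
  - by rewrite ler_wpM2l// hl.
rewrite le_eqVlt; apply/orP; left; apply/eqP; field; exact: lt0r_neq0.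
Qed.
End riemann_liouville.

(** * Hölder continuity of Riemann-Liouville integrals *)

Lemma continuous_bounded_itv {R : realType} (q : R -> R) (x y : R) :
  continuous q -> exists2 B, 0 <= B & forall s, x <= s <= y -> `|q s| <= B.
Proof.
move=> cq.
have /compact_bounded[M [_ hM]] : compact (q @` `[x, y]).
  by apply: continuous_compact; [exact: continuous_subspaceT | exact: segment_compact].
exists (`|M| + 1); first by rewrite addr_ge0.
move=> s hs; apply: hM; first by rewrite ltr_pwDr// ler_norm.
by exists s => //=; rewrite in_itv.
Qed.

Section riemann_liouville_continuous.
Context {R : realType}.
Variable a : R.
Hypothesis ha : 0 < a < 1.
Notation mu := (@lebesgue_measure R).
Notation J := (RL_integral a).
Implicit Types (q : R -> R) (x y t : R).

Let a_gt0 : 0 < a. Proof. by case/andP: ha. Qed.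

(** The kernel for [t1] dominates the one for [t2], so the absolute value of their difference
    integrates without loss: at most [(t1^a - t2^a + (t2 - t1)^a) / a], where [t1^a <= t2^a]. *)
Lemma abel_kernel_shift_le q (B t1 t2 : R) : continuous q ->
  0 < t1 -> t1 < t2 -> (forall s, 0 <= s <= t1 -> `|q s| <= B) ->
  `|\int[mu]_(s in `[0, t1]) ((t1 - s) `^ (a - 1) * q s) -
    \int[mu]_(s in `[0, t1]) ((t2 - s) `^ (a - 1) * q s)| <=
  B * (a^-1 * (t2 - t1) `^ a).
Proof.
move=> cq t10 t12 hB.
have B0 : 0 <= B.
  by apply: le_trans (hB 0 _) => //; rewrite lexx ltW.
have sub : (`[0, t1[%classic : set R) `<=` `[0, t1]%classic.
  by apply: subset_itvl; rewrite bnd_simp.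
have ik t : t1 <= t -> mu.-integrable `[0, t1[ (EFin \o (fun s => (t - s) `^ (a - 1))).
  by move=> t1t; apply: integrableS (integrable_abel_kernel a_gt0 0 t1t) => //.
have iq t : t1 <= t ->
    mu.-integrable `[0, t1[ (EFin \o (fun s => (t - s) `^ (a - 1) * q s)).
  by move=> t1t; apply: integrableS (integrable_abel_kernelM a_gt0 0 cq t1t) => //.
(* At [s = t1] the first kernel has the junk value 0, hence the half-open interval. *)
rewrite -!Rintegral_itv_bndo_bndc//; [|exact: iq (ltW t12)|exact: iq].
rewrite -RintegralB//; [|exact: iq|exact: iq (ltW t12)].
have iD : mu.-integrable `[0, t1[ (EFin \o (fun s => (t1 - s) `^ (a - 1) * q s -
    (t2 - s) `^ (a - 1) * q s)).
  by apply: (integrableB _ (iq _ _) (iq _ (ltW t12))).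
apply: le_trans (le_normr_Rintegral _ iD) _ => //.
have iK : mu.-integrable `[0, t1[ (EFin \o (fun s => (t1 - s) `^ (a - 1) -
    (t2 - s) `^ (a - 1))).
  by apply: (integrableB _ (ik _ _) (ik _ (ltW t12))).
apply: (@le_trans _ _ (\int[mu]_(s in `[0, t1[)
    (B * ((t1 - s) `^ (a - 1) - (t2 - s) `^ (a - 1))))).
  apply: le_Rintegral => //.
  - exact: integrable_norm iD.
  - by apply: (integrableZl _ B iK).
  - move=> s /=; rewrite in_itv/= => /andP[s0 st].
    have k12 : (t2 - s) `^ (a - 1) <= (t1 - s) `^ (a - 1).
      by apply: (abel_kernel_anti ha); rewrite ?subr_gt0// lerD2r ltW.
    rewrite -mulrBl normrM ger0_norm ?subr_ge0// mulrC.
    by rewrite ler_wpM2r ?subr_ge0// hB// s0 ltW.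
rewrite RintegralZl// ler_wpM2l// RintegralB//; [|exact: ik|exact: ik (ltW t12)].
rewrite !Rintegral_itv_bndo_bndc//; [|exact: ik (ltW t12)|exact: ik].
have -> : \int[mu]_(s in `[0, t1]) ((t2 - s) `^ (a - 1)) =
    a^-1 * (t2 `^ a - (t2 - t1) `^ a).
  by rewrite /Rintegral integral_abel_kernel//= subr0.
have := Rintegral_abel_kernel_le a_gt0 (ltW t10); rewrite subr0.
have : a^-1 * t1 `^ a <= a^-1 * t2 `^ a.
  rewrite ler_pM2l ?invr_gt0//.
  apply: ge0_ler_powR; rewrite ?nnegrE; [exact: ltW..| |exact: ltW].
  exact: ltW (lt_trans t10 t12).
by rewrite mulrBr; lra.
Qed.

(** The increment is the integral over [[t1, t2]] plus the effect of shifting the kernel on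
    [[0, t1]]; each is at most [D * (t2 - t1)^a] before the factor [K]. *)
Lemma RL_integral_holder q (M : R) : continuous q ->
  exists2 C, 0 <= C & forall t1 t2, t1 <= t2 -> t2 <= M ->
    `|J q t2 - J q t1| <= C * (t2 - t1) `^ a.
Proof.
move=> cq; have [B B0 hB] := continuous_bounded_itv 0 M cq.
pose K := `|(Gamma a)^-1|; pose D := B * a^-1.
have D0 : 0 <= D by rewrite mulr_ge0// invr_ge0 ltW.
have K0 : 0 <= K by exact: normr_ge0.
have last_part t1 t2 : 0 <= t1 -> t1 <= t2 -> t2 <= M ->
    `|\int[mu]_(s in `[t1, t2]) ((t2 - s) `^ (a - 1) * q s)| <=
    D * (t2 - t1) `^ a.
  move=> t10 t12 t2M.
  have iq := integrable_abel_kernelM a_gt0 t1 cq (lexx t2).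
  apply: le_trans (le_normr_Rintegral _ iq) _ => //.
  apply: (@le_trans _ _ (\int[mu]_(s in `[t1, t2]) (B * (t2 - s) `^ (a - 1)))).
    apply: le_Rintegral => //.
    - exact: integrable_norm iq.
    - by apply: (integrableZl _ B (integrable_abel_kernel a_gt0 t1 (lexx t2))).
    - move=> s /=; rewrite in_itv/= => /andP[s1 s2].
      rewrite normrM ger0_norm ?powR_ge0// mulrC ler_wpM2r ?powR_ge0// hB//.
      by rewrite (le_trans t10 s1) (le_trans s2 t2M).
  rewrite RintegralZl//; last exact: integrable_abel_kernel.
  by rewrite /D -mulrA ler_wpM2l// Rintegral_abel_kernel_le.
have pos t1 t2 : 0 <= t1 -> t1 < t2 -> t2 <= M ->
    `|J q t2 - J q t1| <= K * (2 * D) * (t2 - t1) `^ a.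
  (* The case [t1 = 0] is separate because the kernel shift estimate asks for [0 < t1]; only the
     last part is left there. *)
  rewrite le_eqVlt => /predU1P[<-|t10] t12 t2M.
    rewrite (RL_integral_le0 _ _ (lexx 0)) subr0 normrM -mulrA ler_wpM2l//.
    apply: le_trans (last_part 0 t2 _ (ltW t12) t2M) _ => //.
    by rewrite ler_wpM2r ?powR_ge0// ler_peMl// ler1n.
  rewrite /RL_integral -mulrBr normrM -mulrA ler_wpM2l//.
  have iq := integrable_abel_kernelM a_gt0 0 cq (lexx t2).
  rewrite -(subrK (\int[mu]_(s in `[0, t1]) ((t2 - s) `^ (a - 1) * q s))
    (\int[mu]_(s in `[0, t2]) _)).
  rewrite Rintegral_itvB//; [|by rewrite bnd_simp ltW..].
  rewrite Rintegral_itv_obnd_cbnd; last first.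
    apply: integrableS (integrable_abel_kernelM a_gt0 t1 cq (lexx t2)) => //.
    by apply: subset_itvr; rewrite bnd_simp.
  rewrite -addrA; apply: le_trans (ler_normD _ _) _.
  rewrite mulrDl mul1r mulrDl; apply: lerD.
    exact: last_part (ltW t10) (ltW t12) t2M.
  rewrite distrC /D -mulrA; apply: abel_kernel_shift_le => // s /andP[s0 st1].
  by rewrite hB// s0 (le_trans st1)// (le_trans (ltW t12)).
have C0 : 0 <= K * (2 * D) by rewrite mulr_ge0// mulr_ge0.
exists (K * (2 * D)) => //.
move=> t1 t2; rewrite le_eqVlt => /predU1P[->|t12] t2M.
  by rewrite !subrr normr0 powR0 ?mulr0// gt_eqF.
(* For negative [t1], the value at [t1] equals the value 0 at the origin, and moving [t1] up to 0
   only shortens the increment. *)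
have [t10|t10] := leP 0 t1; first exact: pos.
rewrite (RL_integral_le0 _ _ (ltW t10)).
have [t20|t20] := leP t2 0.
  rewrite (RL_integral_le0 _ _ t20) subrr normr0.
  by apply: mulr_ge0; [exact: C0 | exact: powR_ge0].
have := pos 0 t2 (lexx _) t20 t2M.
rewrite (RL_integral_le0 _ _ (lexx 0)) => /le_trans; apply.
rewrite ler_wpM2l//.
apply: ge0_ler_powR; rewrite ?nnegrE ?subr0; [exact: ltW..| |].
  by rewrite subr_ge0 ltW.
by rewrite lerDl oppr_ge0 ltW.
Qed.

Lemma continuous_RL_integral q : continuous q -> continuous (J q).
Proof.
move=> cq t; have [C C0 hC] := RL_integral_holder (t + 1) cq.
apply/cvgrPdist_lt => e e0.
have C1 : 0 < C + 1 by rewrite ltr_wpDl.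
(* [d] solves [(C + 1) * d^a = e]. The radius below is also capped by 1, to stay under [t + 1],
   where the Hölder bound holds. *)
pose d := (e / (C + 1)) `^ a^-1.
have d0 : 0 < d by rewrite powR_gt0 ?divr_gt0.
have dE : d `^ a = e / (C + 1).
  by rewrite /d -powRrM mulVf ?gt_eqF// powRr1 ?ltW// divr_gt0.
have close t1 t2 : t1 <= t2 -> t2 <= t + 1 -> t2 - t1 < d -> `|J q t2 - J q t1| < e.
  move=> t12 t2M td; apply: le_lt_trans (hC _ _ t12 t2M) _.
  apply: (@le_lt_trans _ _ (C * (e / (C + 1)))).
    rewrite ler_wpM2l// -dE; apply: ge0_ler_powR; rewrite ?nnegrE; try exact: ltW.
    by rewrite subr_ge0.
  by rewrite mulrCA -subr_gt0 -[X in X - _]mulr1 -mulrBr mulr_gt0// subr_gt0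
    ltr_pdivrMr// mul1r ltrDl.
apply/nbhs_ballP; exists (Num.min 1 d); first by rewrite /= lt_min ltr01.
move=> t' /=; rewrite /ball/= lt_min => /andP[h1 hd].
have [tt|tt] := leP t' t.
  apply: close => //; first by rewrite lerDl.
  exact: le_lt_trans (ler_norm _) hd.
rewrite distrC; apply: close; first exact: ltW.
  by rewrite -lerBlDl; apply: ltW; apply: le_lt_trans h1; rewrite distrC ler_norm.
by apply: le_lt_trans hd; rewrite distrC ler_norm.
Qed.
End riemann_liouville_continuous.

(** * Limits of sequences with geometrically small increments *)

Lemma cauchy_half_cvg {R : realType} (u : nat -> R) (C : R) :
  (forall n, `|u n.+1 - u n| <= C / 2 ^+ n.+1) ->
  exists l, forall n, `|l - u n| <= C / 2 ^+ n.
Proof.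
move=> hu; pose d n : R := C / 2 ^+ n.
(* Because [d] halves at each step, the bound on increments says that the intervals of centre [u n]
   and radius [d n] are nested. The supremum of their left endpoints lies in all of them. *)
have dS n : d n = d n.+1 + d n.+1.
  by rewrite /d exprS; field; rewrite expf_neq0.
have C0 : 0 <= C.
  by have := le_trans (normr_ge0 _) (hu 0); rewrite pmulr_lge0// invr_gt0 exprn_gt0.
have d0 n : 0 <= d n by rewrite divr_ge0// exprn_ge0.
have loS n : u n - d n <= u n.+1 - d n.+1.
  by have := hu n; rewrite ler_norml -/(d n.+1) (dS n) => /andP[? ?]; lra.
have hiS n : u n.+1 + d n.+1 <= u n + d n.
  by have := hu n; rewrite ler_norml -/(d n.+1) (dS n) => /andP[? ?]; lra.
have lo : nondecreasing_seq (fun n => u n - d n) by apply/nondecreasing_seqP.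
have hi : nonincreasing_seq (fun n => u n + d n) by apply/nonincreasing_seqP.
have lohi m n : u m - d m <= u n + d n.
  have := lo _ _ (leq_maxl m n); have := hi _ _ (leq_maxr m n).
  by have := d0 (maxn m n); rewrite /=; lra.
pose l := sup (range (fun n => u n - d n)).
have nz : range (fun n => u n - d n) !=set0 by exists (u 0%N - d 0%N), 0%N.
have le_l n : u n - d n <= l.
  apply: ub_le_sup; last by exists n.
  by exists (u 0%N + d 0%N) => _ [m _ <-]; exact: lohi.
have l_le n : l <= u n + d n.
  by apply: ge_sup => // _ [m _ <-]; exact: lohi.
exists l => n; rewrite ler_norml -/(d n).
by have := le_l n; have := l_le n => ? ?; apply/andP; split; lra.
Qed.

Lemma half_expr_lt {R : realType} (C e : R) : 0 < e -> exists n, C / 2 ^+ n < e.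
Proof.
move=> e0; exists (Num.truncn (C / e)).+1.
rewrite ltr_pdivrMr ?exprn_gt0// mulrC -ltr_pdivrMr//.
apply: lt_le_trans (Num.Theory.truncnS_gt _) _.
by rewrite -natrX ler_nat ltnW// ltn_expl.
Qed.

Lemma le0_half_expr {R : realType} (C x : R) : (forall n, x <= C / 2 ^+ n) -> x <= 0.
Proof.
move=> h; rewrite leNgt; apply/negP => x0.
have [n hn] := half_expr_lt C x0.
by have := lt_le_trans hn (h n); rewrite ltxx.
Qed.

Lemma continuous_half_limit {R : realType} (u : nat -> R -> R) (v : R -> R) (C : R) :
  (forall n, continuous (u n)) ->
  (forall n t, `|v t - u n t| <= C / 2 ^+ n) -> continuous v.
Proof.
move=> cu hu t; apply/cvgrPdist_lt => e e0.
have e3 : 0 < e / 3 by rewrite divr_gt0.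
have [n hn] := half_expr_lt C e3.
have : \forall t' \near t, `|u n t - u n t'| < e / 3.
  by have := cu n t => /cvgrPdist_lt; exact.
apply: filterS => t' ht.
have h1 := le_lt_trans (hu n t) hn.
have h2 := le_lt_trans (hu n t') hn.
have -> : v t - v t' = (v t - u n t) + (u n t - u n t') - (v t' - u n t') by ring.
apply: le_lt_trans (ler_normB _ _) _.
have := ler_normD (v t - u n t) (u n t - u n t').
lra.
Qed.

(** * Volterra equations with Abel kernel and Lipschitz right-hand side *)

Section volterra.
Context {R : realType}.
Variables (a T L : R) (G : R -> R -> R).
Hypotheses (ha : 0 < a < 1) (hL : 0 < L).
Hypothesis cG : continuous (fun p : R * R => G p.1 p.2).
Hypothesis lipG : forall t u1 u2, 0 <= t <= T ->
  `|G t u1 - G t u2| <= L * `|u1 - u2|.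
Notation J := (RL_integral a).
Implicit Types (h V W : R -> R) (t : R).

Lemma continuous_along V : continuous V -> continuous (fun s => G s (V s)).
Proof.
move=> cV s.
have cp : (fun s => (s, V s)) s' @[s' --> s] --> (s, V s).
  apply: (@cvg_pair _ _ _ _ (nbhs s) (nbhs (V s))); last exact: cV.
  exact: cvg_id.
exact: (@continuous_comp _ _ _ (fun s => (s, V s)) (fun p : R * R => G p.1 p.2)
  s cp (@cG (s, V s))).
Qed.

(* In the norm [sup |u t| * expR (- l * t)] the map [V |-> J (G (.) (V (.)))]
   contracts by 1/2. *)
Lemma volterra_contraction : exists2 l : R, 0 < l & forall V W (B t : R),
  continuous V -> continuous W -> 0 <= t <= T -> 0 <= B ->
  (forall s, 0 <= s <= t -> `|V s - W s| <= B * expR (l * s)) ->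
  `|J (fun s => G s (V s)) t - J (fun s => G s (W s)) t| <= B / 2 * expR (l * t).
Proof.
have e0 : 0 < (2 * L)^-1 by rewrite invr_gt0 mulr_gt0.
have [l l0 hl] := RL_integral_weighted ha e0.
exists l => // V W B t cV cW /andP[t0 tT] B0 h.
have -> : B / 2 = (2 * L)^-1 * (L * B) by field; rewrite gt_eqF.
apply: hl => //; [exact: continuous_along..|by rewrite mulr_ge0// ltW|].
move=> s /andP[s0 st]; apply: le_trans (lipG _ _ _) _.
  by rewrite s0 (le_trans st).
by rewrite -mulrA ler_pM2l// h// s0.
Qed.

(** The weighted difference attains its maximum [B] on [[0, T]] at some [c]; the contraction
    evaluated at [c] gives [B <= B / 2], so [B = 0]. *)
Lemma volterra_unique h V W : continuous V -> continuous W ->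
  (forall t, 0 <= t <= T -> V t = h t + J (fun s => G s (V s)) t) ->
  (forall t, 0 <= t <= T -> W t = h t + J (fun s => G s (W s)) t) ->
  forall t, 0 <= t <= T -> V t = W t.
Proof.
move=> cV cW eV eW t /andP[t0 tT].
have [l l0 contr] := volterra_contraction.
pose D s := `|V s - W s| * expR (- l * s).
have cD : continuous D.
  move=> s; apply: cvgM; last exact: continuous_expRM.
  by apply: cvg_norm; apply: cvgB; [exact: cV | exact: cW].
have T0 := le_trans t0 tT.
have [c + maxD] := EVT_max T0 (@continuous_subspaceT _ _ `[0, T] D cD).
rewrite in_itv/= => cT; set B := D c in maxD.
have DE s : `|V s - W s| = D s * expR (l * s).
  by rewrite /D mulNr expRN mulfVK// gt_eqF// expR_gt0.
have hB s : 0 <= s <= T -> `|V s - W s| <= B * expR (l * s).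
  by move=> sT; rewrite DE ler_pM2r ?expR_gt0// maxD// in_itv.
have B0 : 0 <= B by rewrite mulr_ge0// expR_ge0.
have : `|V c - W c| <= B / 2 * expR (l * c).
  rewrite (eV c cT) (eW c cT) opprD addrACA subrr add0r.
  apply: contr => // s /andP[s0 sc]; apply: hB.
  by rewrite s0 (le_trans sc)//; case/andP: cT.
rewrite DE -/B ler_pM2r ?expR_gt0// => B2.
have {}B0 : B = 0 by lra.
have := hB t; rewrite t0 tT B0 mul0r => /(_ isT).
by rewrite normr_le0 subr_eq0 => /eqP.
Qed.

(** Picard iteration started from [h]. Negative times are included since the delayed term of the
    next step reads [V] there. *)
Lemma volterra_exists h : 0 <= T -> continuous h ->
  exists2 V, continuous V &
    forall t, t <= T -> V t = h t + J (fun s => G s (V s)) t.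
Proof.
move=> T0 ch; have [l l0 contr] := volterra_contraction.
(* Evaluating the iterates at [m t] makes them constant after [T]; before 0 they all equal [h].
   Bounds on [[0, T]] thus become uniform on the line, and the limit is continuous everywhere. *)
pose m t := Num.min t T.
have cm : continuous m.
  by move=> t; apply: (@continuous_min _ _ id (cst T)); [exact: cvg_id|exact: cvg_cst].
have mT t : m t <= T by rewrite /m ge_min lexx orbT.
have mE t : t <= T -> m t = t by move=> tT; rewrite /m min_l.
pose P V t := h (m t) + J (fun s => G s (V s)) (m t).
pose V n := iter n P (h \o m).
have cV n : continuous (V n).
  elim: n => [|n IH] t.
    by apply: continuous_comp; [exact: cm | exact: ch].
  apply: (@continuous_comp _ _ _ m (fun t => h t + J (fun s => G s (V n s)) t)).
    exact: cm.
  apply: cvgD; first exact: ch.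
  by apply: (continuous_RL_integral ha); exact: continuous_along.
have Vm n t : V n t = V n (m t) by case: n => [|n]/=; rewrite /P/= [m (m _)]mE.
have V0 n t : t <= 0 -> V n t = h t.
  move=> t0; have tT := le_trans t0 T0.
  case: n => [|n]/=; rewrite /P/= mE//.
  by rewrite RL_integral_le0// addr0.
have cd : continuous (fun t => V 1%N t - V 0%N t).
  by move=> t; apply: cvgB; exact: cV.
have [C C0 hC] := continuous_bounded_itv 0 T cd.
have step n t : 0 <= t <= T -> `|V n.+1 t - V n t| <= C / 2 ^+ n * expR (l * t).
  elim: n t => [|n IH] t /andP[t0 tT].
    rewrite expr0 divr1; apply: le_trans (hC t _) _; first by rewrite t0.
    rewrite ler_peMr// -expR0 ler_expR; apply: mulr_ge0 => //; exact: ltW.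
  have -> : V n.+2 t - V n.+1 t =
      J (fun s => G s (V n.+1 s)) t - J (fun s => G s (V n s)) t.
    by rewrite /= /P mE// opprD addrACA subrr add0r.
  have -> : C / 2 ^+ n.+1 = C / 2 ^+ n / 2.
    by rewrite exprS; field; rewrite expf_neq0.
  apply: contr => //; first by rewrite t0.
    by rewrite divr_ge0// exprn_ge0.
  by move=> s /andP[s0 st]; apply: IH; rewrite s0 (le_trans st).
(* The weight is replaced by its largest value on [[0, T]]; the factor 2 turns [2 ^+ n] into the
   [2 ^+ n.+1] expected by [cauchy_half_cvg]. *)
pose A := 2 * C * expR (l * T).
have A0 : 0 <= A by rewrite !mulr_ge0 ?expR_ge0.
have stepT n t : `|V n.+1 t - V n t| <= A / 2 ^+ n.+1.
  rewrite Vm (Vm n); have [t0|t0] := leP (m t) 0.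
    by rewrite !V0// subrr normr0 divr_ge0// exprn_ge0.
  apply: le_trans (step n (m t) _) _; first by rewrite mT ltW.
  have -> : A / 2 ^+ n.+1 = C / 2 ^+ n * expR (l * T).
    by rewrite /A exprS; field; rewrite expf_neq0.
  by rewrite ler_wpM2l ?divr_ge0 ?exprn_ge0// ler_expR ler_pM2l.
have /choice[W hW] : forall t, exists w, forall n, `|w - V n t| <= A / 2 ^+ n.
  by move=> t; apply: (cauchy_half_cvg (u := V^~ t)).
have hW' n t : `|W t - V n t| <= A / 2 ^+ n by exact: hW.
have cW : continuous W := continuous_half_limit cV hW'.
exists W => // t tT; apply/eqP; rewrite -subr_eq0 -normr_le0.
apply: (@le0_half_expr _ (A + A * expR (l * T))) => n.
(* The defect of [W] is compared with the exact relation between [V n.+1] and [V n]; both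
   differences vanish as [n] grows. *)
have -> : W t - (h t + J (fun s => G s (W s)) t) = (W t - V n.+1 t) +
    (J (fun s => G s (V n s)) t - J (fun s => G s (W s)) t).
  by rewrite /= /P mE//; ring.
apply: le_trans (ler_normD _ _) _; rewrite mulrDl; apply: lerD.
  apply: le_trans (hW' _ _) _; rewrite ler_wpM2l// lef_pV2 ?posrE ?exprn_gt0//.
  by rewrite ler_eXn2l ?ltr1n.
have [t0|t0] := leP t 0.
  rewrite !RL_integral_le0// subrr normr0.
  by rewrite divr_ge0 ?exprn_ge0// mulr_ge0// expR_ge0.
have An0 : 0 <= A / 2 ^+ n by rewrite divr_ge0 ?exprn_ge0.
apply: (@le_trans _ _ (A / 2 ^+ n / 2 * expR (l * t))).
  apply: contr => //; first by rewrite ltW.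
  move=> s /andP[s0 _]; rewrite distrC; apply: le_trans (hW' _ _) _.
  by rewrite ler_peMr// -expR0 ler_expR mulr_ge0// ltW.
rewrite [leRHS]mulrAC; apply: ler_pM; rewrite ?expR_ge0//.
- by rewrite !divr_ge0 ?exprn_ge0.
- by rewrite ler_pdivrMr// ler_peMr// ler1n.
- by rewrite ler_expR ler_pM2l.
Qed.
End volterra.

(** * The method of steps for the extended delay equation *)

Section delay_volterra.
Context {R : realType}.
Variables (a r T L : R) (F : R -> R -> R -> R) (h : R -> R).
Hypotheses (ha : 0 < a < 1) (hr : 0 < r) (hT : 0 <= T) (hL : 0 < L).
Hypothesis cF : continuous (fun p : R * (R * R) => F p.1 p.2.1 p.2.2).
Hypothesis lipF : forall t u1 u2 w, `|F t u1 w - F t u2 w| <= L * `|u1 - u2|.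
Hypothesis ch : continuous h.
Notation J := (RL_integral a).
Implicit Types (V W : R -> R) (t : R).

(** Without a lower bound on [t], this includes the condition [V = h] on the past. *)
Let solves_until (S : R) V := forall t, t <= T -> t <= S ->
  V t = h t + J (fun s => F s (V s) (V (s - r))) t.

Let frozen_delay V s u := F s u (V (s - r)).

Let continuous_frozen V : continuous V ->
  continuous (fun p : R * R => frozen_delay V p.1 p.2).
Proof.
move=> cV p.
have cVp : {for p, continuous (fun p : R * R => V (p.1 - r))}.
  apply: (@continuous_comp _ _ _ (fun p : R * R => p.1 - r) V); last exact: cV.
  by apply: cvgB; [exact: cvg_fst | exact: cvg_cst].
have c2 : {for p, continuous (fun p : R * R => (p.2, V (p.1 - r)))}.
  apply: (@cvg_pair _ _ _ _ (nbhs p.2) (nbhs (V (p.1 - r)))); last exact: cVp.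
  exact: cvg_snd.
have c3 : {for p, continuous (fun p : R * R => (p.1, (p.2, V (p.1 - r))))}.
  apply: (@cvg_pair _ _ _ _ (nbhs p.1) (nbhs (p.2, V (p.1 - r)))); last exact: c2.
  exact: cvg_fst.
exact: (@continuous_comp _ _ _ (fun p : R * R => (p.1, (p.2, V (p.1 - r))))
  (fun p : R * (R * R) => F p.1 p.2.1 p.2.2) p c3 (@cF _)).
Qed.

Let lip_frozen V S t u1 u2 : 0 <= t <= S ->
  `|frozen_delay V t u1 - frozen_delay V t u2| <= L * `|u1 - u2|.
Proof. by move=> _; exact: lipF. Qed.

(** Induction over steps of length [r]: up to [k.+1%:R * r] the delayed arguments stay below
    [k%:R * r], where [V] and [W] already agree, so both solve the equation with delay frozen at
    [V]. *)
Lemma delay_volterra_unique V W : continuous V -> continuous W ->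
  (forall t, t <= T -> V t = h t + J (fun s => F s (V s) (V (s - r))) t) ->
  (forall t, t <= T -> W t = h t + J (fun s => F s (W s) (W (s - r))) t) ->
  forall t, t <= T -> V t = W t.
Proof.
move=> cV cW eV eW.
have steps k t : t <= T -> t <= k%:R * r -> V t = W t.
  elim: k t => [|k IH] t tT tk.
    by rewrite mul0r in tk; rewrite eV// eW// !RL_integral_le0.
  have [t0|t0] := leP t 0; first by rewrite eV// eW// !RL_integral_le0.
  apply: (volterra_unique ha hL (continuous_frozen cV) (lip_frozen V (S := t))
    (h := h) cV cW); last by rewrite lexx ltW.
  - by move=> s /andP[_ st]; apply: eV; exact: le_trans tT.
  - move=> s /andP[_ st]; rewrite eW ?(le_trans st)//; congr (_ + _).
    apply: eq_RL_integral => u /andP[_ us]; rewrite /frozen_delay IH//.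
      rewrite lerBlDr (le_trans us)// (le_trans st)// (le_trans tT)//.
      by rewrite lerDl ltW.
    rewrite lerBlDr (le_trans us)// (le_trans st)// (le_trans tk)//.
    by rewrite -natr1 mulrDl mul1r.
(* This number of steps of length [r] reaches past [T]. *)
move=> t tT; apply: (steps (Num.truncn (T / r)).+1) => //.
by rewrite (le_trans tT)// -ler_pdivrMr// ltW// Num.Theory.truncnS_gt.
Qed.

Lemma delay_volterra_exists : exists2 V, continuous V &
  forall t, t <= T -> V t = h t + J (fun s => F s (V s) (V (s - r))) t.
Proof.
have steps k : exists2 V, continuous V & solves_until (k%:R * r) V.
  elim: k => [|k [V cV eV]].
    exists h => // t tT; rewrite mul0r => t0.
    by rewrite RL_integral_le0// addr0.
  have [W cW eW] := volterra_exists ha hL (continuous_frozen cV)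
    (lip_frozen V (S := T)) hT ch.
  exists W => // t tT tk.
  have WV s : s <= T -> s <= k%:R * r -> W s = V s.
    move=> sT sk; have [s0|s0] := leP s 0.
      by rewrite eV// eW// !RL_integral_le0.
    apply: (volterra_unique ha hL (continuous_frozen cV) (lip_frozen V (S := s))
      (h := h) cW cV); last by rewrite lexx ltW.
    - by move=> u /andP[_ us]; apply: eW; exact: le_trans sT.
    - by move=> u /andP[_ us]; apply: eV; [exact: le_trans sT|exact: le_trans sk].
  rewrite eW//; congr (_ + _).
  apply: eq_RL_integral => u /andP[_ ut]; rewrite /frozen_delay (WV (u - r))//.
    rewrite lerBlDr (le_trans ut)// (le_trans tT)//.
    by rewrite lerDl ltW.
  rewrite lerBlDr (le_trans ut)// (le_trans tk)//.
  by rewrite -natr1 mulrDl mul1r.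
have [V cV eV] := steps (Num.truncn (T / r)).+1.
exists V => // t tT; apply: eV => //.
by rewrite (le_trans tT)// -ler_pdivrMr// ltW// Num.Theory.truncnS_gt.
Qed.
End delay_volterra.

(** * Globally continuous extensions by clamping *)

Lemma continuous_comp_within {X Y Z : topologicalType} (A : set Y) (f : Y -> Z)
    (g : X -> Y) : {within A, continuous f} -> continuous g ->
  (forall x, A (g x)) -> continuous (f \o g).
Proof.
move=> /subspace_continuousP cf cg Ag x; apply: (@cvg_comp _ _ _ g f).
  2: exact: (cf _ (Ag x)).
move=> P wP; have : nbhs x (fun z => A (g z) -> P (g z)) := cg x _ wP.
by apply: filterS => z; apply; exact: Ag.
Qed.

Section clamp.
Context {R : realType}.
Variables x y : R.
Hypothesis xy : x <= y.

Definition clamp (t : R) : R := Num.max x (Num.min t y).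

Lemma clamp_itv t : x <= clamp t <= y.
Proof. by rewrite /clamp le_max lexx/= ge_max xy ge_min lexx orbT. Qed.

Lemma clamp_id t : x <= t <= y -> clamp t = t.
Proof. by case/andP => xt ty; rewrite /clamp min_l// max_r. Qed.

Lemma clamp_ge t : y <= t -> clamp t = y.
Proof. by move=> yt; rewrite /clamp min_r// max_r. Qed.

Lemma clamp_le t : t <= x -> clamp t = x.
Proof. by move=> tx; rewrite /clamp max_l// ge_min tx. Qed.

Lemma continuous_clamp : continuous clamp.
Proof.
move=> t; apply: (@continuous_max _ _ (cst x) (fun t => Num.min t y)).
  exact: cvg_cst.
by apply: (@continuous_min _ _ id (cst y)); [exact: cvg_id | exact: cvg_cst].
Qed.
End clamp.

(** * Transfer between the delay problem on [[- r, T]] and its extension *)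

Theorem theorem2 (R : realType) (a T r L : R) (phi : R -> R)
    (f : R -> R -> R -> R)
    (ha : 0 < a < 1) (hT : 0 < T) (hr : 0 < r)
    (hphi : {within `[- r, 0], continuous phi})
    (hf : {within `[0, T] `*` setT,
             continuous (fun p : R * (R * R) => f p.1 p.2.1 p.2.2)})
    (hL : 0 < L)
    (hlip : forall t u1 u2 w : R, 0 <= t <= T ->
              `|f t u1 w - f t u2 w| <= L * `|u1 - u2|) :
  exists v : R -> R,
    delay_solution a T r phi f v /\
    forall w : R -> R, delay_solution a T r phi f w ->
      forall t : R, - r <= t <= T -> w t = v t.
Proof.
case: (ha) => /andP[a0 a1].
have r0 : - r <= 0 by rewrite oppr_le0 ltW.
have rT : - r <= T by rewrite (le_trans r0) ?ltW.
have T0 : 0 <= T by exact: ltW.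
pose F s u w := f (clamp 0 T s) u w.
(* [h] is [phi] on the history and the constant [phi 0] afterwards, so [h + J] carries both the
   initial condition and the integral equation. *)
pose h := phi \o clamp (- r) 0.
have cF : continuous (fun p : R * (R * R) => F p.1 p.2.1 p.2.2).
  pose g (p : R * (R * R)) := (clamp 0 T p.1, p.2).
  apply: (continuous_comp_within (g := g) hf); last first.
    by move=> p; split=> //=; rewrite in_itv/=; exact: clamp_itv.
  move=> p; apply: (@cvg_pair _ _ _ _ (nbhs (clamp 0 T p.1)) (nbhs p.2)); last exact: cvg_snd.
  apply: (@continuous_comp _ _ _ fst (clamp 0 T)); [exact: cvg_fst|exact: continuous_clamp].
have lipF t u1 u2 w : `|F t u1 w - F t u2 w| <= L * `|u1 - u2|.
  by apply: hlip; exact: clamp_itv.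
have ch : continuous h.
  apply: (continuous_comp_within hphi); first exact: continuous_clamp.
  by move=> t /=; rewrite in_itv/=; exact: clamp_itv.
have h_ge0 t : 0 <= t -> h t = phi 0 by move=> t0; rewrite /h/= clamp_ge.
(* Any solution, extended by constants outside [[- r, T]], solves the extended equation for all
   [t <= T]: before [- r] both it and [h] equal [phi (- r)]. Uniqueness for the extended equation
   then applies to it. *)
have extend w : delay_solution a T r phi f w -> [/\ continuous (w \o clamp (- r) T),
    forall t, - r <= t <= T -> (w \o clamp (- r) T) t = w t &
    forall t, t <= T -> (w \o clamp (- r) T) t = h t +
      RL_integral a (fun s => F s ((w \o clamp (- r) T) s)
        ((w \o clamp (- r) T) (s - r))) t].
  case=> cw ew wphi; split.
  - apply: (continuous_comp_within cw); first exact: continuous_clamp.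
    by move=> t /=; rewrite in_itv/=; exact: clamp_itv.
  - by move=> t tT /=; rewrite clamp_id.
  - move=> t tT; have [t0|t0] := leP t 0.
      rewrite RL_integral_le0// addr0 /h/=.
      have [tr|tr] := leP t (- r).
        by rewrite (clamp_le 0 tr) (clamp_le T tr) wphi// lexx.
      have rt0 : - r <= t <= 0 by rewrite t0 ltW.
      by rewrite (clamp_id rt0) clamp_id ?wphi// tT ltW.
    rewrite h_ge0 ?ltW//= clamp_id; last by rewrite tT (le_trans r0) ?ltW.
    rewrite ew; last by rewrite tT ltW.
    rewrite (wphi 0) ?lexx ?r0//; congr (_ + _).
    apply: eq_RL_integral => s /andP[s0 st].
    have sT := le_trans st tT.
    rewrite /F !clamp_id ?s0 ?sT//.
    - by rewrite lerDr s0 lerBlDr (le_trans sT)// lerDl ltW.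
    - by rewrite (le_trans r0).
have [v cv ev] := delay_volterra_exists ha hr T0 hL cF lipF ch.
have v_le0 t : t <= 0 -> v t = h t.
  by move=> t0; rewrite ev ?(le_trans t0)// RL_integral_le0// addr0.
exists v; split.
  split.
  - exact: continuous_subspaceT.
  - move=> t /andP[t0 tT]; rewrite ev// h_ge0// v_le0// h_ge0//; congr (_ + _).
    apply: eq_RL_integral => s /andP[s0 st].
    by rewrite /F clamp_id// s0 (le_trans st).
  - by move=> t rt; have /andP[_ t0] := rt; rewrite v_le0// /h/= clamp_id.
move=> w /extend[cw wE ew] t tT; rewrite -wE//.
apply: (delay_volterra_unique ha hr hL cF lipF cw cv ew ev).
by case/andP: tT.
Qed.
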